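(* Let $T:V\to A$ be a relative Rota-Baxter operator on a left pre-Jacobi-Jordan algebra $(A,\cdot)$ with respect to a representation $(V,\rho,\mu)$. Then for any Nijenhuis element $x\in N_{ij}(T)$ associated to $T$, the family $T_t=T+tJ$ with $J=-\partial_T(x)$, i.e. $$J=T\circ\rho(x)+T\circ\mu(x)-L_x\circ T-R_x\circ T,$$ is a trivial linear deformation of the relative Rota-Baxter operator $T$.
   Context: All vector spaces are finite dimensional over a field $\mathbb{K}$ of characteristic $0$; an algebra is a vector space with a bilinear product, not assumed associative. A left pre-Jacobi-Jordan algebra is an algebra $(A,\cdot)$ whose anti-associator $Aasso(x,y,z):=(x\cdot y)\cdot z+x\cdot(y\cdot z)$ satisfies $Aasso(x,y,z)=-Aasso(y,x,z)$. A representation $(V,\rho,\mu)$ of $(A,\cdot)$ is a vector space $V$ with linear maps $\rho,\mu:A\to gl(V)$ such that for all $x,y\in A$ $$\rho(x\cdot y+y\cdot x)=-\rho(x)\rho(y)-\rho(y)\rho(x),\qquad \mu(y)\mu(x)+\mu(x\cdot y)=-\mu(y)\rho(x)-\rho(x)\mu(y).$$ A linear map $T:V\to A$ is a relative Rota-Baxter operator with respect to $(V,\rho,\mu)$ if $T(u)\cdot T(v)=T(\rho(Tu)v+\mu(Tv)u)$ for all $u,v\in V$. A linear deformation of $T$ is a family $T_t=T+tJ$ with $J:V\to A$ linear such that $T_t$ is a relative Rota-Baxter operator with respect to $(V,\rho,\mu)$ for all $t\in\mathbb{K}$. A morphism from a relative Rota-Baxter operator $T'$ to a relative Rota-Baxter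 operator $T$ (both with respect to $(V,\rho,\mu)$) is a pair $(\phi_A,\phi_V)$ with $\phi_A:A\to A$ a left pre-Jacobi-Jordan algebra morphism and $\phi_V:V\to V$ linear such that $T\circ\phi_V=\phi_A\circ T'$, and $\phi_V\circ\rho(y)=\rho(\phi_A(y))\circ\phi_V$, $\phi_V\circ\mu(y)=\mu(\phi_A(y))\circ\phi_V$ for all $y\in A$. For $u,v\in V$, $x\in A$ put $u\cdot_T v=\rho(Tu)v+\mu(Tv)u$, $\rho_T(v)x=Tv\cdot x-T(\mu(x)v)$, $\mu_T(v)x=x\cdot Tv-T(\rho(x)v)$, and $$C^0(V,A):=\{x\in A:\ \rho_T(u\cdot_T v)x+\rho_T(u)\rho_T(v)x=0\ \ \forall u,v\in V\}.$$ The degree-zero differential is $\partial_T(x)(v)=\rho_T(v)x+\mu_T(v)x$. Write $L_x(y)=x\cdot y$, $R_x(y)=y\cdot x$. A linear deformation $T_t=T+tJ$ of $T$ is trivial if there exists $x\in C^0(V,A)$ such that, for all $t\in\mathbb{K}$, $(Id_A+tL_x+tR_x,\,Id_V+t\rho(x)+t\mu(x))$ is a morphism from $T_t$ to $T$. An element $x\in C^0(V,A)$ is a Nijenhuis element associated to $T$ if for all $y,z\in A$: $$(x\cdot y)\cdot(x\cdot z)+(x\cdot y)\cdot(z\cdot x)+(y\cdot x)\cdot(x\cdot z)+(y\cdot x)\cdot(z\cdot x)=0,$$ $$(x\cdot y)\cdot z+(y\cdot x)\cdot z+y\cdot(x\cdot z)+y\cdot(z\cdot x)=x\cdot(y\cdot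 z)+(y\cdot z)\cdot x,$$ $$\rho(x\cdot y)\rho(x)+\rho(y\cdot x)\rho(x)+\rho(x\cdot y)\mu(x)+\rho(y\cdot x)\mu(x)=0,$$ $$\rho(x\cdot y)+\rho(y\cdot x)+\rho(y)\rho(x)+\rho(y)\mu(x)=\rho(x)\rho(y)+\mu(x)\rho(y),$$ $$\mu(x\cdot y)\mu(x)+\mu(y\cdot x)\mu(x)+\mu(x\cdot y)\rho(x)+\mu(y\cdot x)\rho(x)=0,$$ $$\mu(x\cdot y)+\mu(y\cdot x)+\mu(y)\mu(x)+\mu(y)\rho(x)=\mu(x)\mu(y)+\rho(x)\mu(y),$$ $$(L_x+R_x)\circ T\circ(\rho(x)+\mu(x))-(L_x+R_x)\circ(L_x+R_x)\circ T=0.$$ $N_{ij}(T)$ denotes the set of all Nijenhuis elements associated to $T$. *)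

(* Defs.v *)
From HB Require Import structures.
From mathcomp Require Import all_boot all_order all_algebra.

Set Implicit Arguments.
Unset Strict Implicit.
Unset Printing Implicit Defensive.

Import GRing.Theory.
Local Open Scope ring_scope.

(* A bilinear product on A is curried as mul : 'Hom(A, 'End(A)), so that
   mul x y is the product of x and y, and mul x is the left multiplication. *)
Section PreJacobiJordan.

Variables (K : fieldType) (A V : vectType K).
Variable mul : 'Hom(A, 'End(A)).
Variables rho mu : 'Hom(A, 'End(V)).

Definition anti_associator (x y z : A) : A :=
  mul (mul x y) z + mul x (mul y z).

Definition left_preJJ : Prop :=
  forall x y z : A, anti_associator x y z = - anti_associator y x z.

Definition preJJ_representation : Prop :=
  (forall x y : A,
     rho (mul x y + mul y x) = (- (rho x \o rho y) - (rho y \o rho x))%VF) /\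
  (forall x y : A,
     ((mu y \o mu x) + mu (mul x y))%VF
     = (- (mu y \o rho x) - (rho x \o mu y))%VF).

Definition lmul (x : A) : 'End(A) := mul x.

Definition rmul_fun (x y : A) : A := mul y x.

Fact rmul_fun_is_linear (x : A) : linear (rmul_fun x).
Proof. by move=> a y z; rewrite /rmul_fun linearP !lfunE /= !lfunE. Qed.

HB.instance Definition _ (x : A) :=
  GRing.isLinear.Build K A A _ (rmul_fun x) (rmul_fun_is_linear x).

Definition rmul (x : A) : 'End(A) := linfun (rmul_fun x).

Lemma rmulE (x y : A) : rmul x y = mul y x.
Proof. by rewrite lfunE. Qed.

Definition preJJ_morphism (phi : 'End(A)) : Prop :=
  forall y z : A, phi (mul y z) = mul (phi y) (phi z).

Definition relative_RB (T : 'Hom(V, A)) : Prop :=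
  forall u v : V, mul (T u) (T v) = T (rho (T u) v + mu (T v) u).

Definition relative_RB_morphism (T' T : 'Hom(V, A))
    (phiA : 'End(A)) (phiV : 'End(V)) : Prop :=
  [/\ preJJ_morphism phiA,
      (T \o phiV)%VF = (phiA \o T')%VF,
      forall y : A, (phiV \o rho y)%VF = (rho (phiA y) \o phiV)%VF
    & forall y : A, (phiV \o mu y)%VF = (mu (phiA y) \o phiV)%VF].

Definition deformation (T J : 'Hom(V, A)) (t : K) : 'Hom(V, A) := T + t *: J.

Definition linear_deformation (T J : 'Hom(V, A)) : Prop :=
  forall t : K, relative_RB (deformation T J t).

Section Operator.

Variable T : 'Hom(V, A).

Definition dotT (u v : V) : V := rho (T u) v + mu (T v) u.

Definition rhoT (v : V) (x : A) : A := mul (T v) x - T (mu x v).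

Definition muT (v : V) (x : A) : A := mul x (T v) - T (rho x v).

Definition C0 (x : A) : Prop :=
  forall u v : V, rhoT (dotT u v) x + rhoT u (rhoT v x) = 0.

Definition partialT_fun (x : A) (v : V) : A := rhoT v x + muT v x.

Fact partialT_fun_is_linear (x : A) : linear (partialT_fun x).
Proof.
move=> a u v; rewrite /partialT_fun /rhoT /muT.
have hom_lin (U W : vectType K) (f : 'Hom(U, W)) b (y z : U) :
  f (b *: y + z) = b *: f y + f z by exact: linearP.
have mulE : mul (T (a *: u + v)) x = a *: mul (T u) x + mul (T v) x.
  by rewrite !hom_lin !lfunE /= !lfunE.
rewrite mulE !hom_lin !opprD !scalerDr !scalerN.
rewrite (addrACA (a *: mul (T u) x)) (addrACA (a *: mul x (T u))).
by rewrite (addrACA (a *: _ - _)).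
Qed.

HB.instance Definition _ (x : A) :=
  GRing.isLinear.Build K V A _ (partialT_fun x) (partialT_fun_is_linear x).

Definition partialT (x : A) : 'Hom(V, A) := linfun (partialT_fun x).

Lemma partialTE (x : A) (v : V) : partialT x v = rhoT v x + muT v x.
Proof. by rewrite lfunE. Qed.

Definition trivial_linear_deformation (J : 'Hom(V, A)) : Prop :=
  linear_deformation T J /\
  exists2 x : A, C0 x &
    forall t : K,
      relative_RB_morphism (deformation T J t) T
        (\1%VF + t *: lmul x + t *: rmul x)
        (\1%VF + t *: rho x + t *: mu x).

Record nijenhuis (x : A) : Prop := Nijenhuis {
  nij_C0 : C0 x;
  nij_mul2 : forall y z : A,
    mul (mul x y) (mul x z) + mul (mul x y) (mul z x)
    + mul (mul y x) (mul x z) + mul (mul y x) (mul z x) = 0;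
  nij_mul1 : forall y z : A,
    mul (mul x y) z + mul (mul y x) z + mul y (mul x z) + mul y (mul z x)
    = mul x (mul y z) + mul (mul y z) x;
  nij_rho2 : forall y : A,
    ((rho (mul x y) \o rho x) + (rho (mul y x) \o rho x)
     + (rho (mul x y) \o mu x) + (rho (mul y x) \o mu x))%VF = 0;
  nij_rho1 : forall y : A,
    (rho (mul x y) + rho (mul y x) + (rho y \o rho x) + (rho y \o mu x))%VF
    = ((rho x \o rho y) + (mu x \o rho y))%VF;
  nij_mu2 : forall y : A,
    ((mu (mul x y) \o mu x) + (mu (mul y x) \o mu x)
     + (mu (mul x y) \o rho x) + (mu (mul y x) \o rho x))%VF = 0;
  nij_mu1 : forall y : A,
    (mu (mul x y) + mu (mul y x) + (mu y \o mu x) + (mu y \o rho x))%VF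
    = ((mu x \o mu y) + (rho x \o mu y))%VF;
  nij_T :
    (((lmul x + rmul x) \o T \o (rho x + mu x))
     - ((lmul x + rmul x) \o (lmul x + rmul x) \o T))%VF = 0
}.

End Operator.

End PreJacobiJordan.

(* Main.v *)
(** With [N = L_x + R_x] and [M = rho x + mu x], the Nijenhuis identities say
    that [(N, M)] is an infinitesimal automorphism of the algebra together with
    its representation, with [N y * N z = 0], [rho (N y) M = 0] and
    [mu (N y) M = 0], and that [N J = 0] for [J = T M - N T].  Hence
    [1 + t (N, M)] is a genuine morphism for every [t].  The Rota-Baxter
    identity for [T + t J] splits into its coefficients in [t]: the linear one
    is the derivative of the identity for [T] along [(N, M)]; the quadratic one
    follows by applying [N] to the linear one, since [N J = 0], and using the
    identity for [T] at [(M u, M v)]. *)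

Require Import Defs.
From HB Require Import structures.
From mathcomp Require Import all_boot all_order all_algebra.

Set Implicit Arguments.
Unset Strict Implicit.
Unset Printing Implicit Defensive.

Import GRing.Theory.
Local Open Scope ring_scope.

Section HomBilinear.

Variables (K : fieldType) (U V W : vectType K) (f : 'Hom(U, 'Hom(V, W))).

Lemma homD (g : 'Hom(U, W)) u v : g (u + v) = g u + g v.
Proof. exact: linearD. Qed.

Lemma hom2D u u' v : f (u + u') v = f u v + f u' v.
Proof. by rewrite linearD lfunE. Qed.

Lemma hom2B u u' v : f (u - u') v = f u v - f u' v.
Proof. by rewrite linearB !lfunE /= lfunE. Qed.

Lemma hom20 v : f 0 v = 0.
Proof. by rewrite linear0 lfunE. Qed.

Lemma hom2Z a u v : f (a *: u) v = a *: f u v.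
Proof. by rewrite linearZ lfunE. Qed.

End HomBilinear.

Section SquareZeroDerivation.

Variables (K : fieldType) (A V : vectType K).
Variable mul : 'Hom(A, 'End(A)).
Variables rho mu : 'Hom(A, 'End(V)).
Variables (N : 'End(A)) (M : 'End(V)).

Hypothesis N_mul : forall y z, N (mul y z) = mul (N y) z + mul y (N z).
Hypothesis M_rho : forall y v, M (rho y v) = rho (N y) v + rho y (M v).
Hypothesis M_mu : forall y v, M (mu y v) = mu (N y) v + mu y (M v).
Hypothesis mulNN : forall y z, mul (N y) (N z) = 0.
Hypothesis rhoNM : forall y v, rho (N y) (M v) = 0.
Hypothesis muNM : forall y v, mu (N y) (M v) = 0.

Lemma preJJ_morphism_derivation t : preJJ_morphism mul (\1%VF + t *: N).
Proof.
move=> y z; rewrite !lfunE /= !lfunE /= N_mul hom2D hom2Z !linearD !linearZ /=.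
by rewrite mulNN !scaler0 addr0 addrA addrAC.
Qed.

(** The two sides differ by [t ^+ 2] times [r (N y) (M v)], which is zero. The map [r] is generic so
    as to serve for both [rho] and [mu]. *)
Lemma intertwine_derivation (r : 'Hom(A, 'End(V))) t y :
    (forall y v, M (r y v) = r (N y) v + r y (M v)) ->
    (forall y v, r (N y) (M v) = 0) ->
  ((\1 + t *: M) \o r y = r ((\1 + t *: N)%R y) \o (\1 + t *: M))%VF.
Proof.
move=> M_r rNM; apply/lfunP => v; rewrite !lfunE /= !lfunE /= !lfunE /=.
rewrite M_r hom2D hom2Z !linearD !linearZ /=.
by rewrite rNM !scaler0 addr0 addrA addrAC.
Qed.

Variables T J : 'Hom(V, A).
Hypothesis TRB : relative_RB mul rho mu T.
Hypothesis JE : forall v, J v = T (M v) - N (T v).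
Hypothesis NJ : forall v, N (J v) = 0.

Lemma RB_linear_coef u v :
  mul (J u) (T v) + mul (T u) (J v)
  = T (rho (J u) v + mu (J v) u) + J (rho (T u) v + mu (T v) u).
Proof.
rewrite [J (_ + _)]JE -TRB N_mul (linearD M) /= M_rho M_mu addrA -linearD /=.
rewrite !JE !hom2B !linearB /= !TRB.
(* Both sides subtract the Leibniz expansion of [N (mul (T u) (T v))]. Under [T], the terms in
   [N (T u)] and [N (T v)] coming from [J] cancel those coming from [M_rho] and [M_mu]. *)
rewrite addrACA -opprD; congr (_ - _); rewrite -linearD /=; congr (T _).
by rewrite [RHS]addrACA !(addrA (_ - _)) !subrK addrACA [mu _ _ + _]addrC.
Qed.

Lemma RB_quadratic_coef u v :
  mul (J u) (J v) = J (rho (J u) v + mu (J v) u).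
Proof.
have NT : N (T (rho (J u) v + mu (J v) u))
    = mul (J u) (N (T v)) + mul (N (T u)) (J v).
  have /(congr1 N) := RB_linear_coef u v.
  by rewrite !(homD N) NJ addr0 !N_mul !NJ hom20 linear0 add0r addr0 => <-.
(* On the image of [M], the part [N (T w)] of [J w] acts by zero. *)
have rM w w' : rho (J w) (M w') = rho (T (M w)) (M w').
  by rewrite JE hom2B rhoNM subr0.
have mM w w' : mu (J w) (M w') = mu (T (M w)) (M w').
  by rewrite JE hom2B muNM subr0.
rewrite [RHS]JE NT (linearD M) /= M_rho M_mu !NJ !hom20 !add0r.
rewrite rM mM -TRB opprD addrA.
(* Expanding [J u] and [J v] on both sides, the only unmatched product is that of [N (T u)] and
   [N (T v)], which is zero. *)
by rewrite (JE v) !linearB /= mulNN !oppr0 addr0 [RHS]addrAC JE hom2B.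
Qed.

Lemma linear_deformation_derivation : linear_deformation mul rho mu T J.
Proof.
move=> t u v; have := RB_linear_coef u v; have := RB_quadratic_coef u v.
rewrite /deformation !lfunE /= !lfunE /= !hom2D !hom2Z addrACA -scalerDr.
(* The right side is [T + t *: J] at [P + t *: Q], with coefficients [T P], [T Q + J P] and
   [J Q]. *)
have := TRB u v; set P := rho (T u) v + _; set Q := rho (J u) v + _.
clearbody P Q => c0 c2 c1; rewrite !linearD !linearZ /= c0 c2 addrACA -!addrA.
by congr (_ + _); rewrite !addrA -!scalerDr c1.
Qed.

End SquareZeroDerivation.

Theorem theorem4p23 (K : fieldType) (charK0 : [pchar K] =i pred0)
    (A V : vectType K) (mul : 'Hom(A, 'End(A))) (rho mu : 'Hom(A, 'End(V)))
    (T : 'Hom(V, A)) (x : A) :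
  left_preJJ mul ->
  preJJ_representation mul rho mu ->
  relative_RB mul rho mu T ->
  nijenhuis mul rho mu T x ->
  let J : 'Hom(V, A) := - partialT mul rho mu T x in
  J = ((T \o rho x) + (T \o mu x) - (lmul mul x \o T) - (rmul mul x \o T))%VF
  /\ trivial_linear_deformation mul rho mu T J.
Proof.
move=> _ _ TRB [xC0 mul2 mul1 rho2 rho1 mu2 mu1 NTnij] J.
pose N := lmul mul x + rmul mul x; pose M := rho x + mu x.
have NE y : N y = mul x y + mul y x by rewrite lfunE /= rmulE.
have ME v : M v = rho x v + mu x v by rewrite lfunE.
have JE v : J v = T (M v) - N (T v).
  rewrite lfunE /= partialTE ME NE /rhoT /muT opprD !opprB addrACA -opprD.
  by rewrite -linearD /= (addrC (mu x v)) (addrC (mul (T v) x)).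
have NJ v : N (J v) = 0.
  rewrite JE linearB /=.
  (* The last Nijenhuis identity is exactly [N] composed with [J]. *)
  move: NTnij => /lfunP/(_ v).
  by rewrite add_lfunE opp_lfunE !comp_lfunE zero_lfunE.
have N_mul y z : N (mul y z) = mul (N y) z + mul y (N z).
  by rewrite !NE -mul1 hom2D linearD /= !addrA.
have mulNN y z : mul (N y) (N z) = 0.
  by rewrite !NE hom2D !linearD /= !addrA mul2.
have M_rho y v : M (rho y v) = rho (N y) v + rho y (M v).
  rewrite !ME NE hom2D linearD /=; move: (rho1 y) => /lfunP/(_ v).
  by rewrite !(add_lfunE, comp_lfunE) !addrA => ->.
have M_mu y v : M (mu y v) = mu (N y) v + mu y (M v).
  rewrite !ME !(addrC (rho x _)) NE hom2D linearD /=.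
  move: (mu1 y) => /lfunP/(_ v).
  by rewrite !(add_lfunE, comp_lfunE) !addrA => ->.
have rhoNM y v : rho (N y) (M v) = 0.
  rewrite ME NE linearD /= !hom2D addrA; move: (rho2 y) => /lfunP/(_ v).
  by rewrite !(add_lfunE, comp_lfunE, zero_lfunE).
have muNM y v : mu (N y) (M v) = 0.
  rewrite ME addrC NE linearD /= !hom2D addrA.
  move: (mu2 y) => /lfunP/(_ v).
  by rewrite !(add_lfunE, comp_lfunE, zero_lfunE).
split.
  apply/lfunP => v; rewrite JE ME NE linearD /= opprD addrA.
  by rewrite !(add_lfunE, opp_lfunE, comp_lfunE) rmulE.
split; first exact: linear_deformation_derivation NJ.
exists x => // t; rewrite -!addrA -!scalerDr -/N -/M; clearbody N M.
split.
- exact: preJJ_morphism_derivation.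
- apply/lfunP => v.
  rewrite !(comp_lfunE, add_lfunE, scale_lfunE, id_lfunE).
  (* The [t ^+ 2] term is [N (J v) = 0]; the [t] term is [T (M v) = J v + N (T v)]. *)
  by rewrite !linearD !linearZ /= NJ !scaler0 addr0 JE scalerBr -addrA subrK.
- by move=> y; apply: intertwine_derivation.
- by move=> y; apply: intertwine_derivation.
Qed.
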